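(* There are only finitely many pairs of integers $(m,w)$ with $4\le w\le m-2$ for which an $I(m,w)$ admissible set exists.
   Context: For $m\ge 1$ let $[m]=\{1,\dots,m\}$. For $v\in\{0,1,2\}^m$, the support of $v$ is $\mathrm{Supp}\, v=\{i\in[m]: v_i\neq 0\}$; for $S\subseteq[m]$ let $V_S$ be the set of vectors in $\{0,1,2\}^m$ with support exactly $S$. A subset of $\{0,1,2\}^m$ is called $I(m,w)$ if it contains exactly one element of $V_S$ for each $S\subseteq[m]$ with $|S|=w$, and no other elements. Two vectors $v_1,v_2$ form a clash if $\mathrm{Supp}\, v_1\subseteq \mathrm{Supp}\, v_2$. Three vectors $v_1,v_2,v_3\in\{0,1,2\}^m$ form a clash if there is no coordinate $i$ at which exactly one of $v_1,v_2,v_3$ is non-zero, and no coordinate $i$ at which the three values $(v_1)_i,(v_2)_i,(v_3)_i$ are pairwise distinct (i.e. exactly two are non-zero and they differ). A subset of $\{0,1,2\}^m$ is admissible if it contains no clash (no two distinct elements forming a clash and no three distinct elements forming a clash). *)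

(* Defs.v *)
From mathcomp Require Import all_boot.
From mathcomp Require Import classical_sets cardinality.

Set Implicit Arguments.
Unset Strict Implicit.
Unset Printing Implicit Defensive.

(* Coordinates are shifted: [m] = {1, ..., m} becomes 'I_m = {0, ..., m-1}. *)
Definition vec (m : nat) := {ffun 'I_m -> 'I_3}.

Definition supp (m : nat) (v : vec m) : {set 'I_m} :=
  [set i | v i != ord0]%SET.

Definition VS (m : nat) (S : {set 'I_m}) : {set vec m} :=
  [set v : vec m | supp v == S]%SET.

Definition is_I (m w : nat) (A : {set vec m}) : Prop :=
  (forall S : {set 'I_m}, #|S| = w -> #|A :&: VS S| = 1) /\
  (forall v : vec m, v \in A -> #|supp v| = w).

Definition clash2 (m : nat) (v1 v2 : vec m) : bool :=
  supp v1 \subset supp v2.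

(* The sum of booleans counts how many of the three entries are non-zero. *)
Definition exactly_one_nonzero (m : nat) (v1 v2 v3 : vec m) (i : 'I_m) : bool :=
  (v1 i != ord0) + (v2 i != ord0) + (v3 i != ord0) == 1.

Definition pairwise_distinct_at (m : nat) (v1 v2 v3 : vec m) (i : 'I_m) : bool :=
  [&& v1 i != v2 i, v1 i != v3 i & v2 i != v3 i].

Definition clash3 (m : nat) (v1 v2 v3 : vec m) : bool :=
  ~~ [exists i, exactly_one_nonzero v1 v2 v3 i] &&
  ~~ [exists i, pairwise_distinct_at v1 v2 v3 i].

(* [clash2] is not symmetric, but the quantification is over ordered pairs,
   so inclusion of supports is excluded in both directions. *)
Definition admissible (m : nat) (A : {set vec m}) : Prop :=
  (forall v1 v2 : vec m, v1 \in A -> v2 \in A -> v1 != v2 ->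
     ~~ clash2 v1 v2) /\
  (forall v1 v2 v3 : vec m, v1 \in A -> v2 \in A -> v3 \in A ->
     v1 != v2 -> v1 != v3 -> v2 != v3 -> ~~ clash3 v1 v2 v3).

(* Main.v *)
(* Encode an admissible I(m,w) by the signs of its vectors on their supports.
   Fixing w - 4 coordinates as common support points, three supports behave
   like three 4-subsets of the remaining points. If m - w is large, Ramsey's
   theorem for 4-sets gives six points where the sign of a point in a 4-set
   depends only on its rank: the clashes with supports Cab, Cac, Cbc force
   the four signs to alternate, and then the clash with supports abcd, abef,
   cdef is unavoidable. If w is large, keep w + 2 points, so that supports
   are complements of edges; Ramsey's theorem for triples makes the sign of a
   vertex depend only on its rank relative to the missing edge, and stars and
   matchings of edges force three pairwise distinct signs. Hence both m - w
   and w are bounded. *)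

Require Import Defs.
From mathcomp Require Import all_boot.
From mathcomp Require Import classical_sets cardinality.
From mathcomp Require Import zify.

Set Implicit Arguments.
Unset Strict Implicit.
Unset Printing Implicit Defensive.

(** * Ramsey's theorem for sequences *)

Lemma pigeonhole_count (C : finType) (n : nat) (s : seq C) :
  #|C| * n < size s -> exists k, n < count_mem k s.
Proof.
move=> lt_s; apply/existsP; apply: contraLR lt_s => /existsPn le_n.
rewrite -leqNgt -sum1_size (partition_big id predT) //=.
rewrite -sum_nat_const; apply: leq_sum => k _.
by rewrite sum1_count leqNgt; apply: le_n.
Qed.

(** Subsets are subsequences, so a colour may list data by position in the order. *)
Definition homogeneous (C T : eqType) (c : seq T -> C) (r : nat) (k : C)
    (t : seq T) :=
  forall u, subseq u t -> size u = r -> c u = k.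

(* The colour of a subsequence of size [r.+1] is determined by its first
   element, [ks] listing these colours along [t]. *)
Fixpoint end_homogeneous (C T : eqType) (c : seq T -> C) (r : nat)
    (ks : seq C) (t : seq T) : Prop :=
  match t, ks with
  | [::], [::] => True
  | x :: t', k :: ks' =>
      homogeneous (fun u => c (x :: u)) r k t' /\ end_homogeneous c r ks' t'
  | _, _ => False
  end.

Lemma end_homogeneous_mask (C T : eqType) (c : seq T -> C) r k ks t :
  end_homogeneous c r ks t ->
  size ks = size t /\
  homogeneous c r.+1 k (mask [seq k' == k | k' <- ks] t).
Proof.
elim: t ks => [|x t IHt] [|k0 ks] //= => [_|[hom_x /IHt[-> hom_t]]].
  by split=> // u; rewrite subseq0 => /eqP->.
split=> // -[//|y u]; case: eqP hom_t => [<-|_] hom_t /=; last exact: hom_t.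
case: eqP => [->|_] sub_u; last exact: (hom_t (y :: u)).
by case=> size_u; apply: hom_x => //; apply: subseq_trans sub_u (mask_subseq _ _).
Qed.

(** Induction on [r]: fixing the head lowers [r] by one and yields a long end-homogeneous
    subsequence, in which the pigeonhole principle finds [n] heads of one colour. [N] comes before
    [T] because the ground set ['I_m] varies. *)
Theorem ramsey (C : finType) (r n : nat) :
  exists N, forall (T : eqType) (c : seq T -> C) (s : seq T), N <= size s ->
  exists t k, [/\ subseq t s, size t = n & homogeneous c r k t].
Proof.
elim: r n => [|r IHr] n.
  exists n => T c s le_n; exists (take n s), (c [::]).
  by split=> [||u _ /size0nil->//]; rewrite ?take_subseq ?size_takel.
have [N hN] : exists N, forall (T : eqType) (c : seq T -> C) (s : seq T),
    N <= size s -> exists t ks,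
    [/\ subseq t s, size t = (#|C| * n).+1 & end_homogeneous c r ks t].
  elim: (_.+1) => [|l [N hN]].
    by exists 0 => T c s _; exists [::], [::]; rewrite sub0seq.
  have [M hM] := IHr N; exists M.+1 => T c [//|x s] /= le_M.
  have [t [k [sub_t size_t hom_t]]] := hM T (fun u => c (x :: u)) s le_M.
  have [|t' [ks [sub_t' size_t' hom_t']]] := hN T c t; first by rewrite size_t.
  exists (x :: t'), (k :: ks); split=> /=.
  - by rewrite eqxx (subseq_trans sub_t').
  - by rewrite size_t'.
  - by split=> // u /subseq_trans/(_ sub_t'); apply: hom_t.
exists N => T c s /(hN T c)[t [ks [sub_t size_t hom_t]]].
have [size_ks _] := end_homogeneous_mask (c [::]) hom_t.
have [|k lt_n] := @pigeonhole_count C n ks; first by rewrite size_ks size_t.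
have [_ hom_k] := end_homogeneous_mask k hom_t.
exists (take n (mask [seq k' == k | k' <- ks] t)), k; split.
- by apply: subseq_trans (take_subseq _ _) (subseq_trans (mask_subseq _ _) sub_t).
- rewrite size_takel // size_mask ?size_map // count_map.
  by apply: ltnW; apply: leq_trans lt_n _; rewrite -(eq_count (a1 := pred1 k)).
- by move=> u sub_u; apply: hom_k; apply: subseq_trans sub_u (take_subseq _ _).
Qed.

(** * Signs of an admissible set *)

(** With membership bits and signs at one coordinate, this is the case of entries 0, 1, 2 in some
    order. *)
Definition only_two (x y z : bool) (b1 b2 b3 : bool) : bool :=
  [|| [&& x, y, ~~ z & b1 != b2], [&& x, ~~ y, z & b1 != b3]
    | [&& ~~ x, y, z & b2 != b3]].

Lemma only_two_congr (x y z b1 b2 b3 b1' b2' b3' : bool) :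
  (x -> b1 = b1') -> (y -> b2 = b2') -> (z -> b3 = b3') ->
  only_two x y z b1 b2 b3 = only_two x y z b1' b2' b3'.
Proof.
rewrite /only_two; case: x y z => [] [] [] hx hy hz //=; move: hx hy hz.
all: by do ?[move=> /(_ isT)-> | move=> _].
Qed.

(* [b S i] tells which of 1 and 2 is the [i]th entry of the vector with
   support [S]; it is junk unless [#|S| = w] and [i \in S]. *)
Definition sign_rule (m w : nat) (b : {set 'I_m} -> 'I_m -> bool) : Prop :=
  forall S1 S2 S3 : {set 'I_m}, #|S1| = w -> #|S2| = w -> #|S3| = w ->
  S1 != S2 -> S1 != S3 -> S2 != S3 ->
  (forall i, (i \in S1) + (i \in S2) + (i \in S3) != 1) ->
  exists i, only_two (i \in S1) (i \in S2) (i \in S3) (b S1 i) (b S2 i) (b S3 i).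

Lemma admissible_sign_rule (m w : nat) (A : {set vec m}) :
  is_I w A -> admissible A -> exists b, @sign_rule m w b.
Proof.
move=> [exA _] [_ no_clash3].
(* The default is never reached when [#|S| = w]. *)
pose g S : vec m := odflt [ffun=> ord0] [pick v in A :&: VS S].
have gP (S : {set 'I_m}) : #|S| = w -> g S \in A /\ supp (g S) = S.
  move=> /exA card1; rewrite /g; case: pickP => [v|none] /=.
    by rewrite !inE => /andP[-> /eqP].
  by move: card1; rewrite eq_card0.
exists (fun S i => g S i == 1 :> nat).
move=> S1 S2 S3 /gP[A1 s1] /gP[A2 s2] /gP[A3 s3] n12 n13 n23 no_one.
have neq (S S' : {set 'I_m}) :
    supp (g S) = S -> supp (g S') = S' -> S != S' -> g S != g S'.
  by move=> sS sS'; apply: contraNneq => eqg; rewrite -sS -sS' eqg.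
have := no_clash3 _ _ _ A1 A2 A3 (neq _ _ s1 s2 n12) (neq _ _ s1 s3 n13)
  (neq _ _ s2 s3 n23).
have sE (S : {set 'I_m}) i : supp (g S) = S -> (g S i != ord0) = (i \in S).
  by move=> sS; rewrite -{2}sS inE.
rewrite negb_and !negbK => /orP[/existsP[i]|/existsP[i dist]].
  by rewrite /exactly_one_nonzero !sE // (negPf (no_one i)).
exists i; move: dist (no_one i); rewrite /pairwise_distinct_at -!sE //.
move: (g S1 i) (g S2 i) (g S3 i).
by do 3!case=> [[|[|[|?]]] ?].
Qed.

(** * Restriction to a few points *)

(* [coherent l n q] is [sign_rule n q] on a ground set of [l] points, with
   subsets encoded by their indicator bit sequences. *)
Definition coherent (l n : nat) (q : bitseq -> nat -> bool) : Prop :=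
  forall a1 a2 a3 : bitseq,
  all (fun a => (size a == l) && (count id a == n)) [:: a1; a2; a3] ->
  uniq [:: a1; a2; a3] ->
  all (fun j => nth false a1 j + nth false a2 j + nth false a3 j != 1)
    (iota 0 l) ->
  has (fun j => only_two (nth false a1 j) (nth false a2 j) (nth false a3 j)
                         (q a1 j) (q a2 j) (q a3 j)) (iota 0 l).

Lemma mem_mask_nth (T : eqType) (x0 : T) (s : seq T) (a : bitseq) (j : nat) :
  uniq s -> size a = size s -> j < size s ->
  (nth x0 s j \in mask a s) = nth false a j.
Proof.
elim: s a j => [|z s IHs] [|c a] [|j] //= /andP[z_s uniq_s] [size_a] lt_j.
  by case: c; rewrite ?inE ?eqxx //; apply: contraNF z_s => /mem_mask.
rewrite -(IHs a) //; case: c; rewrite ?inE //.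
by case: eqP => // eq_z; rewrite -eq_z mem_nth in z_s.
Qed.

Lemma nth_mask_rank (T : Type) (x0 : T) (s : seq T) (a : bitseq) (j : nat) :
  nth false a j ->
  nth x0 (mask a s) (count id (take j a)) = nth x0 s j.
Proof.
elim: s a j => [|z s IHs] [|c a] [|j] //=; rewrite ?mask0 ?nth_nil //.
- by case: c.
- by case: c => /= /IHs->.
Qed.

Lemma count_take_ltn (a : bitseq) (j : nat) :
  nth false a j -> count id (take j a) < count id a.
Proof.
elim: a j => [|c a IHa] [|j] //= => [->|/IHa] //.
by rewrite ltn_add2l.
Qed.

(** Adding [X] to three subsets of [t] gives supports of size [w]. A point outside [t] lies in all
    three or in none, so only points of [t] can separate them. *)
Lemma sign_rule_coherent (m w n : nat) (b : {set 'I_m} -> 'I_m -> bool)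
    (X : {set 'I_m}) (x0 : 'I_m) (t : seq 'I_m) (q : bitseq -> nat -> bool) :
  sign_rule w b -> uniq t -> (forall i, i \in t -> i \notin X) ->
  #|X| + n = w ->
  (forall a j, size a = size t -> count id a = n -> nth false a j ->
     b (X :|: [set:: mask a t]) (nth x0 t j) = q a j) ->
  coherent (size t) n q.
Proof.
move=> b_rule uniq_t disjXt cardX bq a1 a2 a3 /=.
move=> /and4P[/andP[/eqP s1 /eqP c1] /andP[/eqP s2 /eqP c2]].
move=> /andP[/eqP s3 /eqP c3] _; rewrite !inE negb_or andbT.
move=> /andP[/andP[n12 n13] n23] /allP no_one.
pose S a : {set 'I_m} := X :|: [set:: mask a t].
have S_out a i : i \notin t -> (i \in S a) = (i \in X).
  by move=> it; rewrite !inE (contraNF (@mem_mask _ _ _ _) it) orbF.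
have S_nth a j : size a = size t -> j < size t ->
    (nth x0 t j \in S a) = nth false a j.
  by move=> sa lt_j; rewrite !inE mem_mask_nth // (negPf (disjXt _ _)) ?mem_nth.
have cardS a : size a = size t -> count id a = n -> #|S a| = w.
  move=> sa ca; rewrite -cardX -ca -(size_mask sa) cardsU.
  rewrite (_ : X :&: _ = finset.set0) ?cards0 ?subn0.
    by rewrite -(card_uniqP (mask_uniq uniq_t a)) cardsE.
  apply/setP=> i; rewrite !inE; apply/negP=> /andP[iX /mem_mask/disjXt].
  by rewrite iX.
have neqS a a' : size a = size t -> size a' = size t -> a != a' -> S a != S a'.
  move=> sa sa'; apply: contraNneq => eqS.
  apply/eqP/(@eq_from_nth _ false) => [|j]; rewrite sa ?sa' // => lt_j.
  by rewrite -!S_nth // eqS.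
have [i|i] := b_rule _ _ _ (cardS _ s1 c1) (cardS _ s2 c2) (cardS _ s3 c3)
  (neqS _ _ s1 s2 n12) (neqS _ _ s1 s3 n13) (neqS _ _ s2 s3 n23).
  have [it|it] := boolP (i \in t); last by rewrite !S_out //; case: (_ \in _).
  rewrite -(nth_index x0 it) !S_nth ?index_mem //.
  by apply: no_one; rewrite mem_iota index_mem.
have [it|it] := boolP (i \in t); last first.
  by rewrite !S_out // /only_two; case: (_ \in _).
rewrite -(nth_index x0 it) !S_nth ?index_mem // => only2.
apply/hasP; exists (index i t); first by rewrite mem_iota index_mem.
by rewrite -(only_two_congr (bq _ _ s1 c1) (bq _ _ s2 c2) (bq _ _ s3 c3)).
Qed.

(** * Contradictions on six points *)

(** The triples force in turn [p0 != p1], [p1 != p2], [p2 != p3], and then [p0 != p2] or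
    [p1 != p3]. *)
Lemma rank_sign_incoherent (p0 p1 p2 p3 : bool) :
  ~ coherent 6 4
      (fun a j => nth false [:: p0; p1; p2; p3] (count id (take j a))).
Proof.
move=> coh.
have := coh [:: true; true; false; true; true; false]
  [:: true; false; true; true; true; false]
  [:: false; true; true; true; true; false] erefl erefl erefl.
have := coh [:: true; true; true; true; false; false]
  [:: true; true; false; true; true; false]
  [:: false; true; true; true; true; false] erefl erefl erefl.
have := coh [:: true; true; true; true; false; false]
  [:: true; true; true; false; true; false]
  [:: true; true; false; true; true; false] erefl erefl erefl.
have := coh [:: true; true; true; true; false; false]
  [:: true; true; false; false; true; true]
  [:: false; false; true; true; true; true] erefl erefl erefl.
by case: p0 p1 p2 p3 {coh} => [] [] [] [].
Qed.

(** Two stars of missing edges give [p1 != p2] and [p0 != p1]; a perfect matching gives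
    [p0 != p2]. *)
Lemma corank_sign_incoherent (p0 p1 p2 : bool) :
  ~ coherent 6 4
      (fun a j => nth false [:: p0; p1; p2] (count negb (take j a))).
Proof.
move=> coh.
have := coh [:: false; false; true; true; true; true]
  [:: false; true; false; true; true; true]
  [:: false; true; true; false; true; true] erefl erefl erefl.
have := coh [:: false; true; false; true; true; true]
  [:: true; false; false; true; true; true]
  [:: true; true; false; false; true; true] erefl erefl erefl.
have := coh [:: true; true; true; true; false; false]
  [:: true; true; false; false; true; true]
  [:: false; false; true; true; true; true] erefl erefl erefl.
by case: p0 p1 p2 {coh} => [] [] [].
Qed.

(** * Bounds on [m - w] and [w] *)

Lemma bounded_codimension : exists M, forall (m w : nat)
    (b : {set 'I_m} -> 'I_m -> bool),
  4 <= w <= m -> sign_rule w b -> m - w < M.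
Proof.
have [M hM] := ramsey (bool * bool * bool * bool)%type 4 6.
exists M => m w b /andP[w_ge4 w_le] b_rule; rewrite ltnNge; apply/negP => le_M.
pose X : {set 'I_m} := [set:: take (w - 4) (enum 'I_m)].
pose c (u : seq 'I_m) :=
  let f := nth false [seq b (X :|: [set:: u]) x | x <- u] in
  (f 0, f 1, f 2, f 3).
have [|t [[[[p0 p1] p2] p3] [sub_t size_t hom_t]]] :=
    hM _ c (drop (w - 4) (enum 'I_m)).
  by rewrite size_drop size_enum_ord; lia.
have := enum_uniq 'I_m; rewrite -(cat_take_drop (w - 4) (enum 'I_m)) cat_uniq.
case/and3P=> uniq_X /hasPn disj uniq_s.
have x0 : 'I_m by case: (t) size_t => //.
apply: (@rank_sign_incoherent p0 p1 p2 p3); rewrite -size_t.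
refine (sign_rule_coherent (X := X) (x0 := x0) b_rule _ _ _ _)
  => [||| a j sz_a cnt_a a_j].
- exact: subseq_uniq sub_t uniq_s.
- by move=> i /(mem_subseq sub_t)/disj; rewrite !inE.
- rewrite cardsE (card_uniqP uniq_X) size_takel ?size_enum_ord; lia.
have lt_j : j < size t.
  by rewrite -sz_a ltnNge; apply: contraL a_j => /(nth_default _)->.
have := hom_t (mask a t) (mask_subseq _ _); rewrite size_mask // => /(_ cnt_a).
rewrite /c; set f := b _ => -[<- <- <- <-].
rewrite -(nth_map x0 false) // -(nth_mask_rank false (map f t) a_j) map_mask.
by have := count_take_ltn a_j; rewrite cnt_a; case: (count _ _) => [|[|[|[|]]]].
Qed.

Lemma bounded_weight : exists M, forall (m w : nat)
    (b : {set 'I_m} -> 'I_m -> bool),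
  4 <= w -> w + 2 <= m -> sign_rule w b -> w < M.
Proof.
have [M hM] := ramsey (bool * bool * bool)%type 3 6.
exists M => m w b w_ge4 w_le b_rule; rewrite ltnNge; apply/negP => le_M.
pose s := take (w + 2) (enum 'I_m).
(* For a triple [u], the sign of [x] when the other two points of [u] form the missing edge. *)
pose f (u : seq 'I_m) x := b ([set:: s] :\: ([set:: u] :\ x)) x.
pose c (u : seq 'I_m) :=
  let g := nth false [seq f u x | x <- u] in (g 0, g 1, g 2).
have size_s : size s = w + 2 by rewrite size_takel ?size_enum_ord.
have [|t [[[p0 p1] p2] [sub_t size_t hom_t]]] := hM _ c s.
  by rewrite size_s; lia.
have uniq_s : uniq s by apply: take_uniq; apply: enum_uniq.
have uniq_t := subseq_uniq sub_t uniq_s.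
have x0 : 'I_m by case: (t) size_t.
apply: (@corank_sign_incoherent p0 p1 p2); rewrite -size_t.
pose X : {set 'I_m} := [set:: s] :\: [set:: t].
refine (sign_rule_coherent (X := X) (x0 := x0) b_rule uniq_t _ _ _)
  => [i it|| a j sz_a cnt_a a_j].
- by rewrite !inE it.
- rewrite cardsD (finset.setIidPr _); last first.
    by apply/fintype.subsetP=> i; rewrite !inE; apply: (mem_subseq sub_t).
  by rewrite !cardsE !(card_uniqP _) // size_s size_t; lia.
have lt_j : j < size t.
  by rewrite -sz_a ltnNge; apply: contraL a_j => /(nth_default _)->.
(* [a'] selects the triple made of point [j] and the two points missed by [a]; the rank of [j] in it
   counts the missed points before [j]. *)
pose a' := set_nth false (map negb a) j true.
have sz_a' : size a' = size t.
  by rewrite size_set_nth size_map sz_a; apply/maxn_idPr.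
have a'_j : nth false a' j by rewrite nth_set_nth /= eqxx.
have cnt_a' : count id a' = 3.
  rewrite count_set_nth_ltn ?size_map ?sz_a // (nth_map false) ?sz_a // a_j.
  have := count_predC id a; rewrite cnt_a sz_a size_t count_map /=.
  by rewrite (eq_count (a2 := predC id)) //; case: (count (predC _) _) => [|[|[]]].
have take_a' : count negb (take j a) = count id (take j a').
  rewrite /a' set_nthE size_map sz_a lt_j take_size_cat.
    by rewrite -map_take count_map; apply: eq_count.
  by rewrite size_takel // size_map sz_a ltnW.
have -> : b (X :|: [set:: mask a t]) (nth x0 t j) = f (mask a' t) (nth x0 t j).
  congr (b _ _); apply/setP=> i; rewrite !inE.
  have [it|it] := boolP (i \in t); last first.
    by rewrite !(contraNF (@mem_mask _ _ _ _) it) andbF orbF.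
  rewrite (mem_subseq sub_t it) andbT -(nth_index x0 it).
  rewrite !mem_mask_nth ?index_mem // nth_uniq ?index_mem // nth_set_nth /=.
  case: eqP => [->|_]; first by rewrite a_j.
  by rewrite (nth_map false) ?sz_a ?index_mem // negbK andbT.
have := hom_t (mask a' t) (mask_subseq _ _); rewrite size_mask // => /(_ cnt_a').
rewrite /c -[f (mask a' t) (nth _ _ _)](nth_map x0 false) //.
rewrite -(nth_mask_rank false _ a'_j) map_mask take_a' => -[<- <- <-].
by have := count_take_ltn a'_j; rewrite cnt_a'; case: (count _ _) => [|[|[|]]].
Qed.

Local Open Scope classical_set_scope.

Theorem theorem1 :
  finite_set [set mw : nat * nat |
    [/\ 4 <= mw.2, mw.2 + 2 <= mw.1 &
        exists A : {set vec mw.1}, is_I mw.2 A /\ admissible A]].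
Proof.
have [M1 hM1] := bounded_codimension; have [M2 hM2] := bounded_weight.
(* Both bounds together give [m = (m - w) + w < M1 + M2]. *)
apply: (@sub_finite_set _ _ (`I_(M1 + M2) `*` `I_(M1 + M2))); last first.
  by apply: finite_setX; apply: finite_II.
move=> [m w] /= [w_ge4 w_le [A [isI adm]]].
have [b b_rule] := admissible_sign_rule isI adm.
have := hM1 m w b _ b_rule; have := hM2 m w b w_ge4 w_le b_rule.
by move=> lt_w /(_ ltac:(lia)) lt_m; split => /=; lia.
Qed.
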